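(* Let $\mathbf{c}=(c_n)_{n\ge1}$ be an oscillating sequence of complex numbers satisfying the growth condition $\sum_{n=1}^N|c_n|^\lambda=O(N)$ for some $\lambda>1$. Then $\mathbf{c}$ is linearly disjoint from the flow $(S^1,T)$ for every Denjoy counter-example $T:S^1\to S^1$.
   Context: $S^1$ is the unit circle with its usual metric. A Denjoy counter-example is an orientation-preserving homeomorphism $T:S^1\to S^1$ with irrational rotation number $\rho$ such that for every $z\in S^1$ the $\omega$-limit set $\omega(z)$ is a Cantor set $\Lambda$ (independent of $z$); equivalently, $T$ is semi-conjugate, via a continuous onto but not injective map, to the rotation $R_\rho(z)=e^{2\pi i\rho}z$ with $\rho$ irrational, but not conjugate to it. A sequence $(c_n)_{n\ge1}$ of complex numbers is oscillating if $\lim_{N\to\infty}\frac1N\sum_{n=1}^N c_n e^{-2\pi i n t}=0$ for every $t\in[0,1)$. For a compact metric space $X$ and a continuous map $T:X\to X$, $(c_n)$ is linearly disjoint from the flow $(X,T)$ if $\lim_{N\to\infty}\frac1N\sum_{n=1}^N c_n f(T^n x)=0$ for every continuous $f:X\to\mathbb{C}$ and every $x\in X$. *)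

(* Defs.v *)
(* MathComp-Analysis development: R is an arbitrary realType, and the complex
   numbers are R[i], from mathcomp-real-closed. *)
From HB Require Import structures.
From mathcomp Require Import all_boot all_order all_algebra.
From mathcomp Require Import all_classical all_reals all_analysis.
From mathcomp Require Import complex.

Set Implicit Arguments.
Unset Strict Implicit.
Unset Printing Implicit Defensive.

Import Order.TTheory GRing.Theory Num.Theory.
Import numFieldNormedType.Exports.

Local Open Scope classical_set_scope.
Local Open Scope ring_scope.
Local Open Scope complex_scope.

(* The libraries do not declare this instance. Balls of R[i] have radii in R[i];
   as 0 < e forces e to be real, this is the usual topology of the plane. *)
HB.instance Definition _ (R : realType) := NormedModule.copy R[i] R[i]^o.

(* exp(2 pi i t) *)
Definition expi2pi (R : realType) (t : R) : R[i] :=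
  cos (2 * pi * t) +i* sin (2 * pi * t).

(* As a type, circle R is the subtype set_type (circle R), with the topology
   induced by R[i]. *)
Definition circle (R : realType) : set R[i] := [set z | `|z| = 1].
Arguments circle : clear implicits.

Lemma circle_expi2pi (R : realType) (t : R) : expi2pi t \in circle R.
Proof. by rewrite inE /circle /= normc_def /= cos2Dsin2 sqrtr1. Qed.

Definition circle_point (R : realType) (t : R) : circle R :=
  exist _ (expi2pi t) (circle_expi2pi t).

(* Sequences (c_n)_{n >= 1} are functions on nat whose value at 0 is ignored. *)

Definition oscillating (R : realType) (c : nat -> R[i]) : Prop :=
  forall t : R, 0 <= t < 1 ->
    (N%:R^-1 * (\sum_(1 <= n < N.+1) c n * expi2pi (- (n%:R * t))) : R[i])
      @[N --> \oo] --> (0 : R[i]).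

(* complex.Re `|z| is the modulus of z as an element of R. *)
Definition growth_condition (R : realType) (lam : R) (c : nat -> R[i]) : Prop :=
  (fun N : nat => \sum_(1 <= n < N.+1) (complex.Re `|c n|) `^ lam : R)
    =O_\oo (fun N : nat => N%:R : R).

Definition linearly_disjoint (R : realType) (X : topologicalType) (T : X -> X)
    (c : nat -> R[i]) : Prop :=
  forall f : X -> R[i], continuous f -> forall x : X,
    (N%:R^-1 * (\sum_(1 <= n < N.+1) c n * f (iter n T x)) : R[i])
      @[N --> \oo] --> (0 : R[i]).

Definition homeomorphism (X : topologicalType) (T : X -> X) : Prop :=
  continuous T /\ exists S : X -> X, [/\ continuous S, cancel T S & cancel S T].

(* F is an increasing lift of T to the universal cover t |-> exp(2 pi i t). *)
Definition increasing_lift (R : realType) (T : circle R -> circle R)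
    (F : R -> R) : Prop :=
  [/\ continuous F, {homo F : x y / x < y}, forall x, F (x + 1) = F x + 1 &
      forall x, T (circle_point x) = circle_point (F x)].

Definition orientation_preserving (R : realType)
    (T : circle R -> circle R) : Prop :=
  exists F : R -> R, increasing_lift T F.

(* The rotation number is only defined modulo 1: every representative rho of it
   satisfies this predicate (replace F by F + k for k an integer), and whether
   rho is irrational does not depend on the representative. *)
Definition rotation_number (R : realType) (T : circle R -> circle R)
    (rho : R) : Prop :=
  exists2 F : R -> R, increasing_lift T F &
    forall x, iter n F x / n%:R @[n --> \oo] --> rho.

Definition omega_limit (X : topologicalType) (T : X -> X) (z : X) : set X :=
  cluster (iter n T z @[n --> \oo]).

(* cantor_like also holds of the empty space. *)
Definition cantor_set (X : topologicalType) (L : set X) : Prop :=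
  L !=set0 /\ cantor_like (set_type L).

Definition denjoy_counterexample (R : realType)
    (T : circle R -> circle R) : Prop :=
  [/\ homeomorphism T, orientation_preserving T,
      exists2 rho : R, irrational rho & rotation_number T rho &
      exists2 L : set (circle R), cantor_set L &
        forall z, omega_limit T z = L].

(* Main.v *)
Require Import Defs.
From mathcomp Require Import all_boot all_order all_algebra.
From mathcomp Require Import all_classical all_reals all_analysis.
From mathcomp Require Import complex.
From mathcomp Require Import zify ring lra.

Import Order.TTheory GRing.Theory Num.Theory.
Import numFieldNormedType.Exports.
Import ComplexField.Normc.

Local Open Scope classical_set_scope.
Local Open Scope ring_scope.
Local Open Scope complex_scope.

Set Implicit Arguments.
Unset Strict Implicit.
Unset Printing Implicit Defensive.

(** Let [F] be an increasing lift of [T], let [rho] be its rotation number,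
    and write [a_n] for the orbit of a point [t] of the line under [F], [e] for
    [expi2pi] and [g] for the test function seen as a function of period one on
    the line.  The theorem says that [c_n] has null correlation with [g (a_n)].

    The orbit has the combinatorics of a rotation: [a_n + m < a_k] whenever
    [n * rho + m < k * rho] ([orbit_order]).  This is the part of the
    semi-conjugacy with the rotation that the argument needs, and it follows
    from the definition of the rotation number by iterating a single inequality.

    The aim is to approximate the bounded sequence [g (a_n)], in mean, by
    trigonometric polynomials in [n * rho]; these have null correlation with
    an oscillating sequence.  The approximant is the convolution of [g (a_j)]
    with the Fejer kernel, averaged over [j < L] ([fejer_average]).  The
    kernel has mean one along the rotation, since its nonzero frequencies give
    bounded geometric sums ([fejer_sum_bound]), and it is small away from the
    integers ([fejer_le]).  Hence only those [j] matter for which [j * rho] is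
    close to [n * rho] modulo one.

    For these, closeness on the rotation side has to give closeness of [a_j] to
    [a_n] modulo one, and this fails at the times [n] at which the orbit is next
    to a wandering interval.  Such times are rare.  Choose [k] and [p] with
    [k * rho - p] positive and tiny ([dirichlet_pos]).  By [orbit_order], a
    [j] with [j * rho] within [k * rho - p] of [n * rho] modulo one has
    [a_j], up to an integer, between [a_(n-k) + p] and [a_(n+k) - p]
    ([orbit_near]).  The length of this interval telescopes when summed over
    [n], and its average is about [2 * (k * rho - p)] ([gap_sum]).  So the
    approximation error is small in mean ([orbit_approx]).

    Passing from approximation in mean to null correlation uses the growth of
    [c]: the part of [c] above a high level [M] contributes little, because
    it is dominated by the average of [|c_n|^lam / M^(lam - 1)]
    ([null_corr_approx]). *)

(** * Real-valued modulus of complex numbers *)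

Section Modulus.
Variable R : realType.
Implicit Types (z w : R[i]) (x y t : R).

Lemma norm_normc z : `|z| = (normc z)%:C.
Proof. by case: z. Qed.

Lemma normc_ge0 z : 0 <= normc z.
Proof. by case: z => a b; rewrite /= sqrtr_ge0. Qed.

Lemma normcD z w : normc (z + w) <= normc z + normc w.
Proof. exact: le_normcD. Qed.

Lemma normcN z : normc (- z) = normc z.
Proof. exact: normcN. Qed.

Lemma normcB z w : normc (z - w) <= normc z + normc w.
Proof. by rewrite -(normcN w); exact: normcD. Qed.

Lemma normc_sum (I : Type) (r : seq I) (P : pred I) (F : I -> R[i]) :
  normc (\sum_(i <- r | P i) F i) <= \sum_(i <- r | P i) normc (F i).
Proof.
elim/big_ind2 : _ => [|z x w y zx wy|//]; first by rewrite normc0.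
exact: le_trans (normcD _ _) (lerD zx wy).
Qed.

Lemma normc_real x : normc x%:C = `|x|.
Proof. by rewrite /= expr0n addr0 sqrtr_sqr. Qed.

Lemma normc_natr n : normc (n%:R : R[i]) = n%:R.
Proof. by rewrite -(rmorph_nat (real_complex R)) normc_real ger0_norm. Qed.

(** The radii of the balls of [R[i]] are positive elements of [R[i]], hence
    real; convergence can therefore be tested with radii in [R], where the order
    is total. *)
Lemma cvg0_normcP (u : nat -> R[i]) :
  u N @[N --> \oo] --> (0 : R[i]) <->
  forall e : R, 0 < e -> \forall N \near \oo, normc (u N) <= e.
Proof.
split=> [/cvgr0Pnorm_le u0 e e0|u0].
  have /u0 : 0 < e%:C by rewrite ltcR.
  by apply: filterS => N; rewrite norm_normc lecR.
apply/cvgr0Pnorm_le => e e0.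
have ereal : e \is Num.real by rewrite realE ltW.
move: e0; rewrite -(RRe_real ereal) ltcR => /u0.
by apply: filterS => N; rewrite norm_normc lecR.
Qed.

End Modulus.

(** * The exponential parametrization of the circle *)

Section Exponential.
Variable R : realType.
Implicit Types (x y t : R).
Local Notation e := (@expi2pi R).

Lemma expi2piD x y : e (x + y) = e x * e y.
Proof.
rewrite /expi2pi mulrDr cosD sinD; apply/eqP; rewrite eq_complex /=.
by rewrite eqxx /= addrC [cos _ * sin _]mulrC mulrC.
Qed.

Lemma expi2pi0 : e 0 = 1.
Proof. by rewrite /expi2pi mulr0 cos0 sin0. Qed.

Lemma expi2pi1 : e 1 = 1.
Proof.
by rewrite /expi2pi mulr1 mulrC mulr_natr cos2pi sin2pi.
Qed.

Lemma normc_expi2pi x : normc (e x) = 1.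
Proof. by rewrite /= cos2Dsin2 sqrtr1. Qed.

Lemma expi2pi_neq0 x : e x != 0.
Proof.
apply/eqP => ex0; have := normc_expi2pi x.
by rewrite ex0 normc0 => /esym/eqP; rewrite oner_eq0.
Qed.

Lemma expi2piN x : e (- x) = (e x)^-1.
Proof.
apply: (mulIf (expi2pi_neq0 x)).
by rewrite -expi2piD addNr expi2pi0 mulVf ?expi2pi_neq0.
Qed.

Lemma expi2pi_conj x : e (- x) = (e x)^*.
Proof. by rewrite /expi2pi mulrN cosN sinN. Qed.

Lemma expi2piX n x : e (n%:R * x) = e x ^+ n.
Proof.
elim: n => [|n IH]; first by rewrite mul0r expi2pi0.
by rewrite -natr1 mulrDl mul1r expi2piD IH exprSr.
Qed.

Lemma expi2pi_int (m : int) : e m%:~R = 1.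
Proof.
case: m => n; last rewrite NegzE mulrNz expi2piN.
  by rewrite -[_%:~R]mulr1 expi2piX expi2pi1 expr1n.
by rewrite -[_%:~R]mulr1 expi2piX expi2pi1 expr1n invr1.
Qed.

Lemma expi2piDz x (m : int) : e (x + m%:~R) = e x.
Proof. by rewrite expi2piD expi2pi_int mulr1. Qed.

(** [acos] finds the angle up to sign, and the sign of the imaginary part
    decides between the two. *)
Lemma circle_expi2pi_onto (z : R[i]) : circle R z -> exists t, e t = z.
Proof.
case: z => a b; rewrite /circle /= normc_def /= => -[/(congr1 (fun x => x ^+ 2))].
rewrite sqr_sqrtr ?addr_ge0 ?sqr_ge0// expr1n => ab.
have a1 : -1 <= a <= 1.
  by rewrite -ler_norml -(@expr_le1 _ 2)// real_normK ?num_real//; nra.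
have pi0 : 2 * pi != 0 :> R by rewrite mulf_neq0// gt_eqF// pi_gt0.
have sb : sin (acos a) = `|b|.
  by rewrite sin_acos// -sqrtr_sqr; congr Num.sqrt; lra.
case: (leP 0 b) => b0.
  exists (acos a / (2 * pi)); rewrite /expi2pi mulrC divfK//.
  by rewrite acosK// sb ger0_norm.
exists (- acos a / (2 * pi)); rewrite /expi2pi mulrC divfK//.
by rewrite cosN acosK// sinN sb ltr0_norm// opprK.
Qed.

Lemma cos_2pi_mono (a b : R) : 0 <= a <= 1 / 2 -> 0 <= b <= 1 / 2 ->
  (cos (2 * pi * a) < cos (2 * pi * b)) = (b < a).
Proof.
have pi0 := pi_gt0 R => /andP[a0 a1] /andP[b0 b1].
rewrite ltr_cos ?in_itv/=; last 2 first.
- by rewrite mulr_ge0 ?(mulr_ge0 _ (ltW _))//=; move: pi0; generalize (@pi R) => z z0; nra.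
- by rewrite mulr_ge0 ?(mulr_ge0 _ (ltW _))//=; move: pi0; generalize (@pi R) => z z0; nra.
by rewrite ltr_pM2l// mulr_gt0.
Qed.

(** The distance to the nearest integer puts the argument of the cosine
    between [0] and [pi], where the cosine is monotone; [expi2pi_away] and
    [expi2pi_neq1] compare cosines there. *)
Lemma normc_1Bexpi2pi x : exists2 m : int, `|x - m%:~R| <= 1 / 2 &
  normc (1 - e x) ^+ 2 = 2 - 2 * cos (2 * pi * `|x - m%:~R|).
Proof.
exists (Num.floor (x + 1 / 2)).
  by have := floor_itv (x + 1 / 2); rewrite intrD ler_norml; lra.
move: (Num.floor _) => m.
have -> : e x = e (x - m%:~R) by rewrite -mulrNz expi2piDz.
have -> y : normc (1 - e y) ^+ 2 = 2 - 2 * cos (2 * pi * y).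
  rewrite /= sqr_sqrtr ?addr_ge0 ?sqr_ge0// sub0r sqrrN.
  have := cos2Dsin2 (2 * pi * y); move: (cos _) (sin _) => a b ab.
  by nra.
have [_|_] := ger0P (x - m%:~R) => //.
by rewrite mulrN cosN.
Qed.

Lemma expi2pi_away (theta : R) : 0 < theta -> theta <= 1 / 2 ->
  exists2 s : R, 0 < s &
  forall x, (forall m : int, theta <= `|x - m%:~R|) -> s <= normc (1 - e x) ^+ 2.
Proof.
move=> t0 t1; exists (2 - 2 * cos (2 * pi * theta)).
  rewrite subr_gt0 gtr_pMr// -[X in _ < X]cos0 -[in X in _ < X](mulr0 (2 * pi)).
  by rewrite cos_2pi_mono ?lexx//; lra.
move=> x xfar; have [m m2 ->] := normc_1Bexpi2pi x.
rewrite lerD2l lerN2 ler_pM2l// leNgt cos_2pi_mono ?normr_ge0//; last by lra.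
by rewrite -leNgt.
Qed.

Lemma expi2pi_neq1 x : (forall m : int, x != m%:~R) -> 1 - e x != 0.
Proof.
move=> xnint; have [m m2 xE] := normc_1Bexpi2pi x.
have xm0 : 0 < `|x - m%:~R| by rewrite normr_gt0 subr_eq0.
apply: contraTneq xm0 => ex1; rewrite -leNgt.
move: xE; rewrite ex1 normc0 expr0n/= => /esym/eqP.
rewrite subr_eq0 -[X in X == _]mulr1 (inj_eq (mulfI _))// => /eqP c1.
by rewrite leNgt -cos_2pi_mono ?lexx ?normr_ge0 ?mulr0 ?cos0 -?c1 ?ltxx//; lra.
Qed.

End Exponential.

(** * Continuous functions of period one *)

Section PeriodicContinuous.
Variable R : realType.
Implicit Types (s t : R) (g : R -> R[i]).

Lemma normc_le_ReIm (z : R[i]) : normc z <= `|complex.Re z| + `|complex.Im z|.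
Proof.
case: z => a b /=; rewrite -[leRHS]ger0_norm ?addr_ge0// -sqrtr_sqr ler_wsqrtr//.
rewrite sqrrD !real_normK ?num_real// -addrA lerD2l lerDr.
by rewrite mulrn_wge0// mulr_ge0.
Qed.

Lemma normc_continuousP g : continuous g <->
  forall t (d : R), 0 < d -> \forall s \near t, normc (g t - g s) <= d.
Proof.
split=> [cg t d d0|cg t].
  have /cvgrPdist_le/(_ d%:C) := cg t; rewrite ltcR => /(_ d0).
  by apply: filterS => s; rewrite norm_normc lecR.
apply/cvgrPdist_le => e e0.
have ereal : e \is Num.real by rewrite realE ltW.
move: e0; rewrite -(RRe_real ereal) ltcR => /(cg t).
by apply: filterS => s; rewrite norm_normc lecR.
Qed.

Lemma continuous_expi2pi : continuous (@expi2pi R).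
Proof.
have lin : continuous (fun t : R => 2 * pi * t) by move=> t; exact: mulrl_continuous.
have ccos : continuous (fun t : R => cos (2 * pi * t)).
  by move=> t; apply: continuous_comp; [exact: lin|exact: continuous_cos].
have csin : continuous (fun t : R => sin (2 * pi * t)).
  by move=> t; apply: continuous_comp; [exact: lin|exact: continuous_sin].
apply/normc_continuousP => t d d0.
have /cvgrPdist_le/(_ (d / 2)) := ccos t; rewrite divr_gt0// => /(_ isT) c1.
have /cvgrPdist_le/(_ (d / 2)) := csin t; rewrite divr_gt0// => /(_ isT) s1.
near=> s; apply: le_trans (normc_le_ReIm _) _ => /=.
by rewrite (splitr d) lerD//; [near: s; exact: c1|near: s; exact: s1].
Unshelve. all: by end_near. Qed.

Lemma continuous_circle_point : continuous (@circle_point R).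
Proof.
have := @continuous_comp_initial _ _ _ (@set_val _ (circle R)) (@circle_point R).
by apply; rewrite set_valE; exact: continuous_expi2pi.
Qed.

(** Compactness is used in its near-covering form: a bound that works near each
    point for all large [B] works on the whole segment for some [B]. *)
Lemma continuous_segment_bounded g (a b : R) : continuous g ->
  exists2 B : R, 0 < B & forall s, a <= s <= b -> normc (g s) <= B.
Proof.
move=> /normc_continuousP cg.
have /compact_near_coveringP := @segment_compact R a b.
move=> /(_ _ (pinfty_nbhs R) (fun (B : R) s => normc (g s) <= B)).
case=> [t _|B [_ bB]]; last first.
  exists (Num.max 1 (B + 1)) => [|s sab]; first by rewrite lt_max ltr01.
  rewrite le_max; apply/orP; right; apply: (bB (B + 1)); first by rewrite ltrDl.
  by rewrite /= in_itv.
near=> s B => /=.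
have : normc (g s) <= normc (g t) + 1.
  rewrite -[g s](subKr (g t)); apply: le_trans (normcB _ _) _.
  by rewrite lerD2l; near: s; exact: cg.
move/le_trans; apply; near: B; apply: nbhs_pinfty_ge; exact: num_real.
Unshelve. all: by end_near. Qed.

(** The point [t] is not confined to the segment, so that a function of period
    one can be compared across the ends of a period. *)
Lemma continuous_segment_uniform g (a b d : R) : continuous g -> 0 < d ->
  exists2 h : R, 0 < h &
    forall s t, a <= s <= b -> `|s - t| < h -> normc (g s - g t) <= d.
Proof.
move=> /normc_continuousP cg d0.
have /compact_near_coveringP := @segment_compact R a b.
move=> /(_ _ (0 : R)^'+
  (fun (h : R) s => forall t, `|s - t| < h -> normc (g s - g t) <= d)).
case=> [t _|h /= h0 hP]; last first.
  exists (h / 2) => [|s t sab st]; first by rewrite divr_gt0.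
  apply: (hP (h / 2)) => //=.
    by rewrite sub0r normrN gtr0_norm ?divr_gt0// ltr_pdivrMr// ltr_pMr// ltr1n.
  by rewrite divr_gt0.
have /(cg t) /nbhs_ballP[r /= r0 rP] : 0 < d / 2 by rewrite divr_gt0.
near=> s h => /= u su.
have ts : `|t - s| < r / 2.
  by near: s; apply: (@cvgr_dist_lt _ _ _ (nbhs t) _ id t) => //; rewrite divr_gt0.
have hr : h < r / 2 by near: h; apply: nbhs_right_lt; rewrite divr_gt0.
have -> : g s - g u = (g t - g u) - (g t - g s) by ring.
apply: le_trans (normcB _ _) _; rewrite (splitr d) lerD// rP// /ball/=; last lra.
rewrite -(subrKA s); apply: le_lt_trans (ler_normD _ _) _; lra.
Unshelve. all: by end_near. Qed.

Definition periodic1 g := forall s, g (s + 1) = g s.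

Lemma periodic1z g : periodic1 g -> forall s (m : int), g (s + m%:~R) = g s.
Proof.
move=> pg; have pn s n : g (s + n%:R) = g s.
  by elim: n => [|n <-]; rewrite ?addr0// -natr1 addrA pg.
move=> s [n|n]; first exact: pn.
by rewrite NegzE mulrNz -(pn (s - n.+1%:R) n.+1) subrK.
Qed.

(** Both points are moved by the same integer, which preserves their
    difference. *)
Lemma periodic1_floor g : periodic1 g -> forall s t, exists s' t',
  [/\ 0 <= s' <= 1, s' - t' = s - t, g s' = g s & g t' = g t].
Proof.
move=> pg s t; exists (s - (Num.floor s)%:~R), (t - (Num.floor s)%:~R).
rewrite -mulrNz !(periodic1z pg) mulrNz; split => //; last by ring.
by have := floor_le s; have := floorD1_gt s; rewrite intrD; lra.
Qed.

Lemma periodic1_bounded g : continuous g -> periodic1 g ->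
  exists2 B : R, 0 < B & forall s, normc (g s) <= B.
Proof.
move=> cg pg; have [B B0 gB] := continuous_segment_bounded 0 1 cg.
exists B => // s; have [s' [_ [s01 _ <- _]]] := periodic1_floor pg s s.
exact: gB.
Qed.

(** Uniform continuity handles the close pairs and boundedness the others.  An
    affine bound is what later sums need: the distances between orbit points are
    small only on average, and the bound passes to averages. *)
Lemma periodic1_modulus g (d : R) : continuous g -> periodic1 g -> 0 < d ->
  exists2 A : R, 0 < A & forall s t, normc (g s - g t) <= d + A * `|s - t|.
Proof.
move=> cg pg d0; have [B B0 gB] := periodic1_bounded cg pg.
have [h h0 gh] := continuous_segment_uniform 0 1 cg d0.
exists (2 * B / h) => [|s t]; first by rewrite divr_gt0// mulr_gt0.
have [s' [t' [s01 <- <- <-]]] := periodic1_floor pg s t.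
have [st|st] := ltP `|s' - t'| h.
  by apply: le_trans (gh _ _ s01 st) _; rewrite lerDl mulr_ge0// divr_ge0 ?ltW// mulr_gt0.
apply: le_trans (normcB _ _) _; apply: (@le_trans _ _ (2 * B)).
  by rewrite mulr_natl mulr2n lerD.
apply: ler_wpDl; first exact: ltW.
by rewrite -mulrA ler_pMr ?mulr_gt0// ler_pdivlMl// mulr1.
Qed.

End PeriodicContinuous.

(** * The order of an orbit and the rotation number *)

Section RotationOrder.
Variables (R : realType) (F : R -> R) (rho : R).
Hypothesis F_incr : {homo F : x y / x < y}.
Hypothesis F_shift : forall x, F (x + 1) = F x + 1.
Hypothesis F_rot : forall x, iter n F x / n%:R @[n --> \oo] --> rho.
Implicit Types (s t : R) (m : int) (n k d q : nat).

Lemma iter_lift_le n : {homo iter n F : x y / x <= y}.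
Proof.
elim: n => [//|n IH] x y xy /=; have := IH _ _ xy.
by rewrite le_eqVlt => /orP[/eqP->//|/F_incr/ltW].
Qed.

Lemma iter_lift_shift n t m : iter n F (t + m%:~R) = iter n F t + m%:~R.
Proof.
have Fn x k : F (x + k%:R) = F x + k%:R.
  by elim: k => [|k IH]; rewrite ?addr0// -natr1 !addrA F_shift IH.
have Fz x : F (x + m%:~R) = F x + m%:~R.
  case: m => k; first exact: Fn.
  by rewrite NegzE mulrNz -[in RHS](subrK k.+1%:R x) Fn addrK.
by elim: n => //= n ->.
Qed.

(** [F] commutes with integer translations, so a comparison of [F^d t] with
    [t + m] can be iterated. *)
Lemma iter_lift_mul_le d q t m :
  iter d F t <= t + m%:~R -> iter (q * d) F t <= t + (m *+ q)%:~R.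
Proof.
move=> dt; elim: q => [|q IH]; first by rewrite mul0n mulr0n addr0.
rewrite mulSn iterD; apply: le_trans (iter_lift_le d IH) _.
by rewrite iter_lift_shift mulrS intrD addrA lerD2r.
Qed.

Lemma iter_lift_mul_ge d q t m :
  t + m%:~R <= iter d F t -> t + (m *+ q)%:~R <= iter (q * d) F t.
Proof.
move=> dt; elim: q => [|q IH]; first by rewrite mul0n mulr0n addr0.
rewrite mulSn iterD; apply: (le_trans _ (iter_lift_le d IH)).
by rewrite iter_lift_shift mulrS intrD addrA lerD2r.
Qed.

Lemma iter_lift_mul_cvg d t :
  (iter (q * d) F t - t) / q%:R @[q --> \oo] --> d%:R * rho.
Proof.
case: d => [|d].
  rewrite mul0r; apply: cvg_near_cst; near=> q.
  by rewrite muln0 subrr mul0r.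
have sub : (fun q => (q * d.+1)%N) @ \oo --> \oo.
  by move=> A [n _ nA]; exists n => // q /= nq; apply: nA => /=; lia.
have h1 : iter (q * d.+1) F t / (q * d.+1)%:R @[q --> \oo] --> rho.
  exact: (cvg_comp _ _ sub (F_rot t)).
have h2 : t / q%:R @[q --> \oo] --> (0 : R).
  rewrite -(mulr0 t); apply: cvgM; first exact: cvg_cst.
  apply/gtr0_cvgV0; last exact: cvgr_idn.
  by near=> q; rewrite ltr0n; near: q; exists 1%N.
rewrite -[X in _ --> X]subr0.
apply: (cvg_trans _ (cvgB (cvgM (cvg_cst (d.+1%:R : R)) h1) h2)).
apply: near_eq_cvg; near=> q.
have q0 : (0 < q)%N by near: q; exists 1%N.
suff : d.+1%:R * (iter (q * d.+1) F t / (q * d.+1)%:R) - t / q%:R =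
  (iter (q * d.+1) F t - t) / q%:R by [].
rewrite natrM mulrBl; field.
by rewrite nat1r !pnatr_eq0 -lt0n q0.
Unshelve. all: by end_near. Qed.

(** Iterate the comparison [q] times, divide by [q], and let [q] tend to
    infinity. *)
Lemma rotation_le d t m : iter d F t <= t + m%:~R -> d%:R * rho <= m%:~R.
Proof.
move=> dt; apply: (cvgr_to_le (@iter_lift_mul_cvg d t)).
near=> q; have q0 : (0 < q)%N by near: q; exists 1%N.
rewrite ler_pdivrMr ?ltr0n// lerBlDr mulr_natr -rmorphMn addrC.
exact: iter_lift_mul_le.
Unshelve. all: by end_near. Qed.

Lemma rotation_ge d t m : t + m%:~R <= iter d F t -> m%:~R <= d%:R * rho.
Proof.
move=> dt; apply: (cvgr_to_ge (@iter_lift_mul_cvg d t)).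
near=> q; have q0 : (0 < q)%N by near: q; exists 1%N.
rewrite ler_pdivlMr ?ltr0n// lerBrDr mulr_natr -rmorphMn addrC.
exact: iter_lift_mul_ge.
Unshelve. all: by end_near. Qed.

(** The integer translates of an orbit are ordered like the numbers
    [n * rho + m].  If the inequality between orbit points failed, then
    [rotation_le] or [rotation_ge], applied at the point with the smaller index,
    would contradict the inequality between the numbers. *)
Lemma orbit_order t n k m :
  n%:R * rho + m%:~R < k%:R * rho -> iter n F t + m%:~R < iter k F t.
Proof.
move=> lt_nk; rewrite ltNge; apply: contraTN lt_nk => le_kn; rewrite -leNgt.
have [nk|/ltnW kn] := leqP n k.
  rewrite -(subnK nk) iterD in le_kn *.
  by rewrite natrD mulrDl addrC lerD2l (rotation_le le_kn).
rewrite -(subnK kn) iterD in le_kn *.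
rewrite natrD mulrDl -subr_ge0 addrAC addrK -[m]opprK mulrNz subr_ge0.
by apply: (rotation_ge (t := iter k F t)); rewrite mulrNz lerBlDr.
Qed.

(** Compare [F^n t] with the translates of [t] by the integers next to
    [n * rho]. *)
Lemma orbit_rotation_dist t n : `|iter n F t - (t + n%:R * rho)| <= 1.
Proof.
set x := n%:R * rho; have c1 := ceilB1_lt x; have c2 := floorD1_gt x.
have c3 := ceil_ge x; have c4 := floor_le x.
have := @orbit_order t 0 n (Num.ceil x - 1); rewrite mul0r add0r => /(_ c1) /= h1.
have := @orbit_order t n 0 (- (Num.floor x + 1)).
rewrite mul0r mulrNz subr_lt0 => /(_ c2) /= h2.
move: c1 c2 h1 h2; rewrite mulrzBr !intrD => c1 c2 h1 h2.
rewrite ler_norml; lra.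
Qed.

End RotationOrder.

(** * Diophantine approximation *)

Section Diophantine.
Variables (R : realType) (rho : R).
Hypothesis rho_irr : irrational rho.

Lemma irrational_mul_neq (k p : int) : k != 0 -> k%:~R * rho != p%:~R.
Proof.
move=> k0; apply/negP => /eqP kp; apply: rho_irr; exists (p%:~R / k%:~R) => //.
have k0R : k%:~R != 0 :> R by rewrite intr_eq0.
by rewrite fmorph_div !rmorph_int -kp mulrAC divff// mul1r.
Qed.

(** Pigeonhole: among the fractional parts of [i * rho] for [i <= Q], two fall
    into the same one of [Q] boxes of length [1 / Q]. *)
Lemma dirichlet_abs (d : R) : 0 < d ->
  exists k p, (0 < k)%N /\ `|k%:R * rho - p%:~R| < d.
Proof.
move=> d0; pose Q := (Num.truncn d^-1).+1.
have Qd : Q%:R^-1 < d.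
  by rewrite invf_plt ?posrE ?ltr0n// truncnS_gt.
pose fr (i : nat) : R := i%:R * rho - (Num.floor (i%:R * rho))%:~R.
have fr01 i : 0 <= fr i < 1.
  have := floor_itv (i%:R * rho); rewrite intrD /fr; lra.
have frQ i : (Num.truncn (fr i * Q%:R) < Q)%N.
  rewrite truncn_lt_nat; last by rewrite mulr_ge0//; have := fr01 i; lra.
  by rewrite gtr_pMl ?ltr0n//; have := fr01 i; lra.
pose box (i : 'I_Q.+1) : 'I_Q := Ordinal (frQ i).
have [i [j [ij eq_box]]] : exists i j : 'I_Q.+1, (i < j)%N /\ box i = box j.
  have /injectivePn[i [j ij eq_box]] : ~~ injectiveb box.
    by apply/injectiveP => /leq_card; rewrite !card_ord ltnn.
  move: ij; rewrite neq_ltn => /orP[ij|ji]; first by exists i, j.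
  by exists j, i.
exists (j - i)%N, (Num.floor (j%:R * rho) - Num.floor (i%:R * rho)).
split; first by rewrite subn_gt0.
have fQ l : (Num.truncn (fr l * Q%:R))%:R <= fr l * Q%:R <
    (Num.truncn (fr l * Q%:R))%:R + 1.
  rewrite natr1 truncn_itv// mulr_ge0//; have := fr01 l; lra.
apply: lt_trans Qd; have -> : (j - i)%:R * rho -
    (Num.floor (j%:R * rho) - Num.floor (i%:R * rho))%:~R = fr j - fr i.
  rewrite (natrB _ (ltnW ij)) intrB /fr.
  by move: (Num.floor _)%:~R (Num.floor _)%:~R => u v; ring.
have Q0 : 0 < Q%:R :> R by rewrite ltr0n.
rewrite -[ltRHS]mul1r ltr_pdivlMr// -(gtr0_norm Q0) -normrM mulrBl.
have := fQ i; have := fQ j; have <- : Num.truncn (fr i * Q%:R) =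
  Num.truncn (fr j * Q%:R) := congr1 val eq_box.
by rewrite ltr_norml; lra.
Qed.

(** When [k * rho - p = - y] is negative, take the largest [q] with
    [q * y <= 1]; then [q * k * rho - (q * p - 1) = 1 - q * y] is less than [y],
    and it is not zero because [rho] is irrational. *)
Lemma dirichlet_pos (d : R) : 0 < d ->
  exists k p, (0 < k)%N /\ 0 < k%:R * rho - p%:~R < d.
Proof.
move=> d0; have dmin0 : 0 < Num.min d 1 by rewrite lt_min d0 ltr01.
have [k [p [k0]]] := dirichlet_abs dmin0; rewrite lt_min => /andP[kp kp1].
have neq l (r : int) : (0 < l)%N -> l%:R * rho - r%:~R != 0.
  by move=> l0; rewrite subr_eq0 (@irrational_mul_neq l)// -lt0n.
have [xneg|xpos|/eqP] := ltgtP (k%:R * rho - p%:~R) 0; last first.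
- by rewrite (negPf (neq _ _ k0)).
- by exists k, p; split => //; rewrite xpos -(gtr0_norm xpos).
pose y := p%:~R - k%:R * rho; have y0 : 0 < y by rewrite subr_gt0 -subr_lt0.
have [yd y1] : y < d /\ y < 1.
  by rewrite /y -opprB -(ltr0_norm xneg) kp kp1.
pose q := Num.truncn y^-1.
have : q%:R <= y^-1 < q.+1%:R by rewrite truncn_itv// invr_ge0 ltW.
rewrite -natr1 -[y^-1]mul1r ler_pdivlMr// ltr_pdivrMr// mulrDl mul1r => /andP[qy yq].
have q0 : (0 < q)%N by rewrite lt0n; apply: contraTneq yq => ->; lra.
exists (q * k)%N, (p *+ q - 1).
have qk0 : (0 < q * k)%N by rewrite muln_gt0 q0.
split; first exact: qk0.
have E : (q * k)%:R * rho - (p *+ q - 1)%:~R = 1 - q%:R * y.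
  by rewrite natrM intrB rmorphMn/= /y -mulr_natl; ring.
have := neq _ (p *+ q - 1) qk0; rewrite E lt_def => ->; rewrite subr_ge0 qy/=; lra.
Qed.

End Diophantine.

(** * The Fejer kernel along an irrational rotation *)

Section FejerKernel.
Variable R : realType.
Implicit Types (x y s rho : R) (m n L : nat).
Local Notation e := (@expi2pi R).

Lemma geometric_expi2pi m x :
  normc (\sum_(r < m) e (r%:R * x)) * normc (1 - e x) <= 2.
Proof.
have -> : \sum_(r < m) e (r%:R * x) = \sum_(r < m) e x ^+ r.
  by apply: eq_bigr => r _; exact: expi2piX.
rewrite -normcM mulrC -opprB mulNr -subrX1 normcN -expi2piX.
apply: le_trans (normcB _ _) _.
by rewrite normc_expi2pi normc1.
Qed.

(** The Fejer kernel [(sin (pi m x) / sin (pi x))^2 / m], in a form that is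
    defined at the integers and visibly nonnegative. *)
Definition fejer m x : R := normc (\sum_(r < m) e (r%:R * x)) ^+ 2 / m%:R.

Lemma fejer_ge0 m x : 0 <= fejer m x.
Proof. by rewrite divr_ge0// sqr_ge0. Qed.

Lemma fejer_le m x s : (0 < m)%N -> 0 < s -> s <= normc (1 - e x) ^+ 2 ->
  fejer m x <= 4 / (s * m%:R).
Proof.
move=> m0 s0 sx; have mR : 0 < m%:R :> R by rewrite ltr0n.
rewrite /fejer ler_pdivrMr// invfM mulrA divfK ?gt_eqF// ler_pdivlMr//.
apply: le_trans (ler_wpM2l (sqr_ge0 _) sx) _.
rewrite -exprMn [leRHS](_ : 4 = 2 ^+ 2); last by rewrite -natrX.
by rewrite lerXn2r ?nnegrE ?mulr_ge0 ?normc_ge0// geometric_expi2pi.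
Qed.

(** Expanding the square shows that the kernel is a trigonometric
    polynomial. *)
Lemma fejerE m x : (fejer m x)%:C =
  m%:R^-1 * \sum_(r < m) \sum_(s < m) e ((r%:R - s%:R) * x).
Proof.
have sq (z : R[i]) : (normc z ^+ 2)%:C = z * z^*.
  rewrite -sqr_normc norm_normc; exact: rmorphXn.
rewrite /fejer rmorphM fmorphV rmorph_nat mulrC /= sq; congr (_ * _).
rewrite rmorph_sum mulr_suml; apply: eq_bigr => r _.
rewrite mulr_sumr; apply: eq_bigr => s _.
by rewrite mulrBl expi2piD expi2pi_conj.
Qed.

(** In the expansion of the kernel, the [m] diagonal terms together contribute
    exactly one for each [j].  Every other term is a geometric sum of ratio
    [e ((s - r) * rho)], which differs from one as [rho] is irrational; such a
    sum is bounded independently of its length and of the base point [y].  The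
    kernel thus has mean one along the rotation, uniformly in [y]. *)
Lemma fejer_sum_bound m rho : irrational rho -> (0 < m)%N ->
  exists2 C : R, 0 <= C & forall y L,
    `|\sum_(j < L) fejer m (y - j%:R * rho) - L%:R| <= C.
Proof.
move=> rho_irr m0.
(* The diagonal summands of [C0] are quotients by zero, whose value is zero;
   the corresponding errors vanish as well. *)
pose C0 : R := \sum_(r < m) \sum_(s < m) 2 / normc (1 - e ((s%:R - r%:R) * rho)).
have C0ge0 : 0 <= C0.
  by rewrite sumr_ge0// => r _; rewrite sumr_ge0// => s _; rewrite divr_ge0 ?normc_ge0.
exists (m%:R^-1 * C0) => [|y L]; first by rewrite mulr_ge0// invr_ge0.
have mC0 : m%:R != 0 :> R[i] by rewrite pnatr_eq0 -lt0n.
rewrite -normc_real rmorphB rmorph_sum rmorph_nat/=.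
pose D (r s : 'I_m) : R[i] := if r == s then L%:R else 0.
have -> : L%:R = m%:R^-1 * \sum_(r < m) \sum_(s < m) D r s :> R[i].
  under eq_bigr => r _ do rewrite /D -big_mkcond (big_pred1 r)//.
  by rewrite sumr_const card_ord -[L%:R *+ m]mulr_natl mulKf.
under eq_bigr => j _ do rewrite fejerE.
rewrite -mulr_sumr -mulrBr normcM normcV normc_natr ler_wpM2l ?invr_ge0//.
rewrite exchange_big -sumrB; apply: le_trans (normc_sum _ _ _) _.
apply: ler_sum => r _; rewrite exchange_big -sumrB.
apply: le_trans (normc_sum _ _ _) _; apply: ler_sum => s _.
rewrite /D; have [->|rs] := eqVneq r s.
  under eq_bigr => j _ do rewrite subrr mul0r expi2pi0.
  by rewrite sumr_const card_ord subrr normc0 divr_ge0 ?normc_ge0.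
set x := (s%:R - r%:R) * rho.
have -> : \sum_(j < L) e ((r%:R - s%:R) * (y - j%:R * rho)) =
    e ((r%:R - s%:R) * y) * \sum_(j < L) e (j%:R * x).
  rewrite mulr_sumr; apply: eq_bigr => j _; rewrite -expi2piD.
  by congr e; rewrite /x; ring.
rewrite subr0 normcM normc_expi2pi mul1r ler_pdivlMr ?geometric_expi2pi//.
rewrite lt_def normc_ge0 andbT; apply: contraNneq (_ : 1 - e x != 0).
  by move/eq0_normc => ->.
apply: expi2pi_neq1 => p; rewrite /x.
have -> : (s%:R - r%:R : R) = (s%:Z - r%:Z)%:~R by rewrite intrB.
apply: irrational_mul_neq => //.
by rewrite subr_eq0 eqz_nat eq_sym.
Qed.

End FejerKernel.

(** * Sequences with null correlation *)

Section NullCorrelation.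
Variable R : realType.
Implicit Types (c u v : nat -> R[i]) (a : R[i]) (t : R).
Local Notation e := (@expi2pi R).

Definition null_corr c u :=
  (N%:R^-1 * (\sum_(1 <= n < N.+1) c n * u n) : R[i]) @[N --> \oo] --> (0 : R[i]).

(** Oscillation is a hypothesis on frequencies in the unit interval, and
    [e (n * t)] depends only on [t] modulo one. *)
Lemma null_corr_expi2pi c t : oscillating c -> null_corr c (fun n => e (n%:R * t)).
Proof.
move=> cosc; pose t' := - t - (Num.floor (- t))%:~R.
have t'01 : 0 <= t' < 1 by have := floor_itv (- t); rewrite intrD /t'; lra.
rewrite /null_corr; under eq_fun => N.
  under eq_bigr => n _.
    have -> : e (n%:R * t) = e (- (n%:R * t')).
      rewrite -mulrN opprB opprK addrC mulrDr -[n%:R]/(n%:Z%:~R) -intrM.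
      by rewrite expi2piDz.
    over.
  over.
exact: cosc t' t'01.
Qed.

Lemma null_corrZ c a u : null_corr c u -> null_corr c (fun n => a * u n).
Proof.
move=> /cvg0_normcP cu; apply/cvg0_normcP => d d0.
have d'0 : 0 < d / (normc a + 1) by rewrite divr_gt0// ltr_wpDl ?normc_ge0.
apply: filterS (cu _ d'0) => N.
rewrite ler_pdivlMr ?ltr_wpDl ?normc_ge0// => cuN.
have -> : N%:R^-1 * (\sum_(1 <= n < N.+1) c n * (a * u n)) =
    (N%:R^-1 * (\sum_(1 <= n < N.+1) c n * u n)) * a.
  rewrite -mulrA mulr_suml; congr (_ * _); apply: eq_bigr => n _.
  by rewrite mulrCA mulrC.
rewrite normcM; apply: le_trans cuN.
by rewrite ler_wpM2l ?normc_ge0// lerDl.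
Qed.

Lemma null_corrD c u v : null_corr c u -> null_corr c v ->
  null_corr c (fun n => u n + v n).
Proof.
move=> /cvg0_normcP cu /cvg0_normcP cv; apply/cvg0_normcP => d d0.
have d'0 : 0 < d / 2 by rewrite divr_gt0.
apply: filterS2 (cu _ d'0) (cv _ d'0) => N cuN cvN.
under eq_bigr => n _ do rewrite mulrDr.
rewrite big_split/= mulrDr; apply: le_trans (normcD _ _) _.
by rewrite (splitr d) lerD.
Qed.

Lemma null_corr_sum c (I : Type) (r : seq I) (u : I -> nat -> R[i]) :
  (forall i, null_corr c (u i)) -> null_corr c (fun n => \sum_(i <- r) u i n).
Proof.
move=> cu; elim: r => [|i r IH].
  apply/cvg0_normcP => d d0; near=> N.
  rewrite big1 => [|n _]; last by rewrite big_nil mulr0.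
  by rewrite mulr0 normc0 ltW.
have -> : (fun n => \sum_(l <- i :: r) u l n) =
  (fun n => u i n + \sum_(l <- r) u l n) by apply/funext => n; rewrite big_cons.
exact: null_corrD.
Unshelve. all: by end_near. Qed.

(** A limit of approximations in mean, with errors bounded by a common [D],
    inherits null correlation.  The bound [|c_n| <= M + |c_n|^lam / M^(lam - 1)]
    splits the contribution of the error: the first term is controlled by the
    mean error, the second by [D] and the growth condition.  The level [M] is
    chosen first, then the approximation. *)
Lemma null_corr_approx c u (lam D : R) : 1 < lam -> growth_condition lam c ->
  (forall d : R, 0 < d -> exists v, [/\ null_corr c v,
     forall n, normc (u n - v n) <= D &
     \forall N \near \oo, \sum_(1 <= n < N.+1) normc (u n - v n) <= d * N%:R]) ->
  null_corr c u.
Proof.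
move=> lam1 cgrow approx; apply/cvg0_normcP => d d0.
have [C C0 cC] : exists2 C : R, 0 < C & \forall N \near \oo,
    \sum_(1 <= n < N.+1) normc (c n) `^ lam <= C * N%:R.
  move/eqO_exP : cgrow => [C C0 cC]; exists C => //.
  apply: filterS cC => N; rewrite [`|N%:R|]ger0_norm//.
  move=> /(le_trans _); apply; rewrite ger0_norm ?sumr_ge0//.
  by move=> n _; exact: powR_ge0.
have D0 : 0 <= D.
  by have [v [_ vD _]] := approx 1 ltr01; exact: le_trans (normc_ge0 _) (vD 0%N).
have lam10 : 0 < lam - 1 by rewrite subr_gt0.
(* [X] is [M^(lam - 1)]; with this choice the tail [D * C / X] is at most
   [d / 3]. *)
pose X := 3 * (D + 1) * C / d.
have X0 : 0 < X by rewrite divr_gt0// !mulr_gt0//; lra.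
pose M := X `^ (lam - 1)^-1.
have M0 : 0 < M by exact: powR_gt0.
have MX : M `^ (lam - 1) = X by rewrite -powRrM mulVf ?gt_eqF// powRr1// ltW.
have cM n : normc (c n) <= M + normc (c n) `^ lam / X.
  have [cn|cn] := leP (normc (c n)) M.
    by rewrite (le_trans cn)// lerDl divr_ge0 ?powR_ge0// ltW.
  have cn0 : 0 < normc (c n) := lt_trans M0 cn.
  apply: ler_wpDl; first exact: ltW.
  rewrite ler_pdivlMr//.
  rewrite -[lam in leRHS](subrK 1) powRD ?(gt_eqF cn0) ?implybT// powRr1 ?ltW//.
  by rewrite mulrC ltr_pM2r// -MX gt0_ltr_powR// nnegrE ltW.
have dM0 : 0 < d / (3 * M) by rewrite divr_gt0// mulr_gt0.
have [v [cv vD vd]] := approx _ dM0.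
near=> N.
have N0 : 0 < N%:R :> R by rewrite ltr0n; near: N; exists 1%N.
have vN : normc (N%:R^-1 * (\sum_(1 <= n < N.+1) c n * v n)) <= d / 3.
  by near: N; move/cvg0_normcP : cv; apply; rewrite divr_gt0.
have dN : \sum_(1 <= n < N.+1) normc (u n - v n) <= d / (3 * M) * N%:R.
  by near: N.
have gN : \sum_(1 <= n < N.+1) normc (c n) `^ lam <= C * N%:R by near: N.
have -> : N%:R^-1 * (\sum_(1 <= n < N.+1) c n * u n) =
    N%:R^-1 * (\sum_(1 <= n < N.+1) c n * v n) +
    N%:R^-1 * (\sum_(1 <= n < N.+1) c n * (u n - v n)).
  by rewrite -mulrDr -big_split; congr (_ * _); apply: eq_bigr => n _ /=; ring.
apply: le_trans (normcD _ _) _.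
have -> : d = d / 3 + 2 * d / 3 by field.
apply: lerD => //; rewrite normcM normcV normc_natr ler_pdivrMl//.
apply: le_trans (normc_sum _ _ _) _.
apply: (@le_trans _ _ (\sum_(1 <= n < N.+1)
    (M * normc (u n - v n) + D / X * normc (c n) `^ lam))).
  apply: ler_sum => n _; rewrite normcM.
  apply: le_trans (ler_wpM2r (normc_ge0 _) (cM n)) _.
  rewrite mulrDl lerD2l mulrC mulrAC mulrA ler_wpM2r ?invr_ge0 ?(ltW X0)//.
  by rewrite ler_wpM2r ?powR_ge0.
rewrite big_split -!mulr_sumr/=.
apply: le_trans (lerD (ler_wpM2l (ltW M0) dN) (ler_wpM2l (divr_ge0 D0 (ltW X0)) gN)) _.
have -> : M * (d / (3 * M) * N%:R) = N%:R * (d / 3) by field; exact: lt0r_neq0.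
have -> : N%:R * (2 * d / 3) = N%:R * (d / 3) + N%:R * (d / 3) by field.
rewrite lerD2l.
have -> : D / X * (C * N%:R) = D / (D + 1) * (N%:R * (d / 3)).
  by rewrite /X; field; rewrite !gt_eqF//; lra.
by rewrite ler_piMl ?mulr_ge0 ?divr_ge0 ?ltW// ltr_pdivrMr; lra.
Unshelve. all: by end_near. Qed.

End NullCorrelation.

(** * Trigonometric approximation along an orbit *)

Section OrbitApproximation.
Variables (R : realType) (F : R -> R) (rho : R) (g : R -> R[i]).
Hypothesis F_incr : {homo F : x y / x < y}.
Hypothesis F_shift : forall x, F (x + 1) = F x + 1.
Hypothesis F_rot : forall x, iter n F x / n%:R @[n --> \oo] --> rho.
Hypothesis rho_irr : irrational rho.
Hypothesis g_cont : continuous g.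
Hypothesis g_per : periodic1 g.
Variable t : R.
Local Notation e := (@expi2pi R).
Local Notation a n := (iter n F t).

(** For [p] slightly less than [k * rho], the points [a i + p] and
    [a (i + 2 * k) - p] lie on either side of [a (i + k)]; this is their
    distance. *)
Definition gap (k : nat) (p : int) (i : nat) : R :=
  a (i + k.*2) - a i - 2 * p%:~R.

(** On the rotation, [j * rho + m] lies between [i * rho + p] and
    [(i + 2 * k) * rho - p], and so does [(i + k) * rho]; the orbit has the same
    order. *)
Lemma orbit_near (k : nat) (p m : int) (i j : nat) :
  `|(i + k)%:R * rho - j%:R * rho - m%:~R| < k%:R * rho - p%:~R ->
  `|a (i + k) - (a j + m%:~R)| <= gap k p i.
Proof.
rewrite ltr_norml => /andP[h1 h2].
have [kp0 E] : 0 < k%:R * rho - p%:~R /\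
    (i + k.*2)%:R = (i + k)%:R + k%:R :> R.
  by split; [lra | rewrite -addnn addnA natrD].
have ord n l (q : int) : n%:R * rho + q%:~R < l%:R * rho -> a n + q%:~R < a l.
  exact: orbit_order.
have Ei : (i + k)%:R = i%:R + k%:R :> R by rewrite natrD.
have o1 : a i + (p - m)%:~R < a j by apply: ord; rewrite intrB; move: h1 h2; rewrite Ei; lra.
have o2 : a j + (m + p)%:~R < a (i + k.*2).
  by apply: ord; rewrite intrD E; move: h1 h2; rewrite Ei; lra.
have o3 : a i + p%:~R < a (i + k) by apply: ord; rewrite Ei; lra.
have o4 : a (i + k) + p%:~R < a (i + k.*2) by apply: ord; rewrite E; lra.
move: o1 o2 o3 o4; rewrite intrB intrD /gap ler_norml => *; lra.
Qed.

Lemma gap_ge0 k p i : 0 < k%:R * rho - p%:~R -> 0 <= gap k p i.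
Proof.
move=> kp0; have := @orbit_near k p 0 i (i + k).
by rewrite subrr subr0 normr0 => /(_ kp0); exact: le_trans.
Qed.

(** The deviation [b n] of the orbit from the rotation is bounded by one, so the
    sum of [b (i + 2 * k) - b i] telescopes to a bounded quantity; what remains
    of each gap is its value for the rotation. *)
Lemma gap_sum k p N : \sum_(i < N) gap k p i <=
  4 * k%:R + N%:R * (2 * (k%:R * rho - p%:~R)).
Proof.
pose b n : R := a n - (t + n%:R * rho).
have b1 n : `|b n| <= 1 by exact: orbit_rotation_dist.
have telescope K : \sum_(i < N) (b (i + K)%N - b i) <= 2 * K%:R.
  elim: K => [|K IH].
    by rewrite big1 ?mulr0// => i _; rewrite addn0 subrr.
  have -> : \sum_(i < N) (b (i + K.+1)%N - b i) =
      \sum_(i < N) (b (i + K)%N - b i) + \sum_(i < N) (b (i.+1 + K)%N - b (i + K)%N).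
    by rewrite -big_split; apply: eq_bigr => i _ /=; rewrite addnS addSn; ring.
  rewrite -[\sum_(i < N) (b (i.+1 + K)%N - _)](big_mkord xpredT
    (fun i => b (i.+1 + K)%N - b (i + K)%N)) (telescope_sumr (fun i => b (i + K)%N))//.
  have := b1 (N + K)%N; have := b1 (0 + K)%N; rewrite -natr1 !ler_norml => *; lra.
have -> : \sum_(i < N) gap k p i =
    \sum_(i < N) (b (i + k.*2)%N - b i) + N%:R * (2 * (k%:R * rho - p%:~R)).
  have -> : N%:R * (2 * (k%:R * rho - p%:~R)) =
      \sum_(i < N) (2 * (k%:R * rho - p%:~R)) by rewrite sumr_const card_ord mulr_natl.
  rewrite -big_split; apply: eq_bigr => i _ /=.
  by rewrite /gap /b natrD -mul2n natrM; ring.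
rewrite lerD2r; apply: le_trans (telescope _) _.
by rewrite -mul2n natrM; lra.
Qed.

(** The sample points [j * rho] of this discrete convolution run over the orbit
    of the rotation itself, so that only values of [g] on the orbit occur. *)
Definition fejer_average (m L : nat) (n : nat) : R[i] :=
  L%:R^-1 * \sum_(j < L) (fejer m (n%:R * rho - j%:R * rho))%:C * g (a j).

Lemma null_corr_fejer_average c m L : oscillating c ->
  null_corr c (fejer_average m L).
Proof.
move=> cosc; apply/null_corrZ/null_corr_sum => j.
have -> : (fun n => (fejer m (n%:R * rho - j%:R * rho))%:C * g (a j)) =
  (fun n => g (a j) * (m%:R^-1 * \sum_(r < m) \sum_(s < m)
     e ((r%:R - s%:R) * - (j%:R * rho)) * e (n%:R * ((r%:R - s%:R) * rho)))).
  apply/funext => n; rewrite mulrC fejerE; congr (_ * (_ * _)).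
  apply: eq_bigr => r _; apply: eq_bigr => s _; rewrite -expi2piD.
  by congr e; ring.
apply/null_corrZ/null_corrZ/null_corr_sum => r; apply: null_corr_sum => s.
exact/null_corrZ/null_corr_expi2pi.
Qed.

(** With [S] the sum of the kernel values [K j], the error equals
    [g (a n) * (1 - S / L)] plus the average of [(g (a n) - g (a j)) * K j].
    If [j * rho] is far from [n * rho] modulo one then [K j] is small; otherwise
    the modulus of continuity and [orbit_near] apply.  The first conclusion
    serves for the finitely many [n < k], and as the bound of the error that
    [null_corr_approx] asks for. *)
Lemma orbit_approx_pointwise (B d A : R) (k m L : nat) (p : int) n :
  (0 < L)%N -> 0 < k%:R * rho - p%:~R -> 0 <= B -> 0 <= d -> d <= 1 -> 0 <= A ->
  (forall s, normc (g s) <= B) ->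
  (forall s s', normc (g s - g s') <= d + A * `|s - s'|) ->
  (forall x, (forall q : int, k%:R * rho - p%:~R <= `|x - q%:~R|) -> fejer m x <= d) ->
  (forall n, `|\sum_(j < L) fejer m (n%:R * rho - j%:R * rho) - L%:R| <= d * L%:R) ->
  normc (g (a n) - fejer_average m L n) <= 5 * B /\
  (forall i, n = (i + k)%N ->
    normc (g (a n) - fejer_average m L n) <= (3 * B + 2) * d + 2 * A * gap k p i).
Proof.
move=> L0 kp0 B0 d0 d1 A0 gB gA farK massK.
have LR : 0 < L%:R :> R by rewrite ltr0n.
have LC : L%:R != 0 :> R[i] by rewrite pnatr_eq0 -lt0n.
pose K j := fejer m (n%:R * rho - j%:R * rho).
have K0 j : 0 <= K j by exact: fejer_ge0.
pose S := \sum_(j < L) K j.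
have SL : `|S - L%:R| <= d * L%:R by exact: massK.
have S2 : S <= 2 * L%:R.
  by move: SL; rewrite ler_norml => /andP[_]; nra.
(* Both conclusions come from bounding the terms of the average by some [V]. *)
have key (V : nat -> R) : (forall j, normc (g (a n) - g (a j)) * K j <= V j) ->
    normc (g (a n) - fejer_average m L n) <= B * d + L%:R^-1 * \sum_(j < L) V j.
  move=> KV.
  have -> : g (a n) - fejer_average m L n = L%:R^-1 *
      (g (a n) * (L%:R - S)%:C + \sum_(j < L) (g (a n) - g (a j)) * (K j)%:C).
    have -> : \sum_(j < L) (g (a n) - g (a j)) * (K j)%:C =
        g (a n) * S%:C - \sum_(j < L) (K j)%:C * g (a j).
      rewrite /S rmorph_sum mulr_sumr -sumrB; apply: eq_bigr => j _ /=.
      by rewrite mulrBl [_ * g (a j)]mulrC.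
    rewrite rmorphB rmorph_nat/= mulrBr addrA subrK mulrBr; congr (_ - _).
    by rewrite mulrC mulfK.
  rewrite normcM normcV normc_natr.
  have -> : B * d = L%:R^-1 * (B * (d * L%:R)) by field; exact: lt0r_neq0.
  rewrite -mulrDr ler_wpM2l ?invr_ge0//; apply: le_trans (normcD _ _) _.
  apply: lerD.
    by rewrite normcM normc_real distrC ler_pM ?normc_ge0.
  apply: le_trans (normc_sum _ _ _) _; apply: ler_sum => j _.
  by rewrite normcM normc_real ger0_norm.
have g2B s s' : normc (g s - g s') <= 2 * B.
  by apply: le_trans (normcB _ _) _; rewrite mulr_natl mulr2n lerD.
split=> [|i ni].
  apply: (le_trans (key (fun j => 2 * B * K j) _)) => [j|].
    by rewrite ler_wpM2r.
  rewrite -mulr_sumr -/S; apply: (@le_trans _ _ (B * 1 + 2 * B * 2)); last by lra.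
  rewrite lerD// ?ler_wpM2l// mulrCA ler_wpM2l ?mulr_ge0//.
  by rewrite ler_pdivrMl// mulrC.
have G0 := @gap_ge0 k p i kp0.
have dG0 : 0 <= d + A * gap k p i by rewrite addr_ge0// mulr_ge0.
apply: (le_trans (key (fun j => (d + A * gap k p i) * K j + 2 * B * d) _)) => [j|].
  have [far|] := pselect (forall q : int,
      k%:R * rho - p%:~R <= `|n%:R * rho - j%:R * rho - q%:~R|).
    apply: ler_wpDl; first exact: mulr_ge0.
    by apply: ler_pM; rewrite ?normc_ge0//; exact: farK.
  move=> /existsNP[q /negP]; rewrite -ltNge {1}ni => near.
  rewrite -[leLHS]addr0 lerD ?mulr_ge0// ler_wpM2r//.
  rewrite -(periodic1z g_per (a j) q); apply: le_trans (gA _ _) _.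
  by rewrite lerD2l ler_wpM2l// ni orbit_near.
rewrite big_split/= -mulr_sumr -/S sumr_const card_ord mulrDr -[2 * B * d *+ L]mulr_natl.
rewrite mulKf ?gt_eqF// mulrCA.
have : L%:R^-1 * S <= 2 by rewrite ler_pdivrMl// mulrC.
move=> /(ler_wpM2l dG0); lra.
Qed.

(** Averaging the pointwise bound: the gaps contribute about [2 * theta] on
    average, and [theta] is chosen after the modulus of continuity [A], so that
    [A * theta] is small.  The order of choices is [d1], [A], [theta] (with [k]
    and [p]), [m], [L]. *)
Lemma orbit_approx c (B : R) (d : R) : oscillating c -> 0 < B ->
  (forall s, normc (g s) <= B) -> 0 < d ->
  exists v, [/\ null_corr c v,
     forall n, normc (g (a n) - v n) <= 5 * B &
     \forall N \near \oo, \sum_(1 <= n < N.+1) normc (g (a n) - v n) <= d * N%:R].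
Proof.
move=> cosc B0 gB d0.
have X0 : 0 < 3 * B + 6 by lra.
have [d1 [d1_0 d1_1 d1_d]] : exists d1 : R,
    [/\ 0 < d1, d1 <= 1 & (3 * B + 6) * d1 <= d / 2].
  exists (Num.min 1 (d / 2 / (3 * B + 6))); split.
  - by rewrite lt_min ltr01 !divr_gt0.
  - by rewrite ge_min lexx.
  - by rewrite mulrC -ler_pdivlMr// ge_min lexx orbT.
have [A A0 gA] := periodic1_modulus g_cont g_per d1_0.
have th0 : 0 < Num.min (1 / 2) (d1 / A) by rewrite lt_min !divr_gt0.
have [k [p [_ /andP[kp0]]]] := dirichlet_pos rho_irr th0.
set theta := _ - _ in kp0 *; rewrite lt_min => /andP[/ltW th1 thA].
have {}thA : A * theta <= d1 by rewrite mulrC -ler_pdivlMr// ltW.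
have [s s0 far] := expi2pi_away kp0 th1.
pose m := (Num.truncn (4 / (s * d1))).+1.
have mK x : (forall q : int, theta <= `|x - q%:~R|) -> fejer m x <= d1.
  move=> /far sx; apply: le_trans (fejer_le _ s0 sx) _ => //.
  rewrite invfM mulrA ler_pdivrMr ?ltr0n// -ler_pdivrMl// [_^-1 * _]mulrC.
  by rewrite -mulrA -invfM ltW// truncnS_gt.
have [C C0 massC] := fejer_sum_bound rho_irr (ltn0Sn _ : (0 < m)%N).
pose L := (Num.truncn (C / d1)).+1.
have massK n : `|\sum_(j < L) fejer m (n%:R * rho - j%:R * rho) - L%:R| <= d1 * L%:R.
  apply: le_trans (massC _ _) _; rewrite -ler_pdivrMl// mulrC ltW//.
  exact: truncnS_gt.
exists (fejer_average m L); have point n := @orbit_approx_pointwise B d1 A k m L p n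
  (ltn0Sn _) kp0 (ltW B0) (ltW d1_0) d1_1 (ltW A0) gB gA mK massK.
split; first exact: null_corr_fejer_average.
  by move=> n; exact: (point n).1.
(* [E] collects what does not grow with [N]: the [k] initial terms, the extra
   term due to the [N + 1] summands from [k] on, and the constant in
   [gap_sum]. *)
pose E := 5 * B * k%:R + (3 * B + 6) * d1 + 8 * A * k%:R.
near=> N.
apply: (@le_trans _ _ (E + N%:R * ((3 * B + 6) * d1))); last first.
  have EN : E <= d / 2 * N%:R.
    rewrite -ler_pdivrMl ?divr_gt0//; near: N.
    exact: nbhs_infty_ger.
  have : N%:R * ((3 * B + 6) * d1) <= N%:R * (d / 2) by rewrite ler_wpM2l.
  lra.
pose D n := normc (g (a n) - fejer_average m L n).
have D0 n : 0 <= D n by exact: normc_ge0.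
apply: (@le_trans _ _ (\sum_(0 <= n < k + N.+1) D n)).
  rewrite [leRHS](@big_cat_nat _ _ _ 1)//= ?addnS//.
  rewrite ler_wpDl ?sumr_ge0// [leRHS](@big_cat_nat _ _ _ N.+1)//=; last by rewrite ltnS leq_addl.
  by rewrite lerDl sumr_ge0.
rewrite (@big_cat_nat _ _ _ k)//= ?leq_addr//.
have -> : \sum_(k <= n < k + N.+1) D n = \sum_(i < N.+1) D (i + k)%N.
  by rewrite -{1}[k]add0n big_addn addKn big_mkord.
have h1 : \sum_(0 <= n < k) D n <= 5 * B * k%:R.
  rewrite big_mkord mulr_natr -[k in leRHS]card_ord -sumr_const.
  by apply: ler_sum => n _; exact: (point n).1.
have h2 : \sum_(i < N.+1) D (i + k)%N <=
    N.+1%:R * ((3 * B + 2) * d1) + 2 * A * \sum_(i < N.+1) gap k p i.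
  rewrite mulr_sumr mulr_natl -[X in _ *+ X]card_ord -sumr_const -big_split/=.
  by apply: ler_sum => i _; exact: (point (i + k)%N).2.
have h3 := ler_wpM2l (ltW A0) (gap_sum k p N.+1).
have h4 := ler_wpM2l (ler0n R N.+1) thA.
move: h2 h3 h4; rewrite -/theta /E -natr1 => h2 h3 h4.
nra.
Unshelve. all: by end_near. Qed.

End OrbitApproximation.

(** * Linear disjointness *)

Lemma circle_point_onto (R : realType) (x : circle R) : exists t, circle_point t = x.
Proof.
have [t xE] := circle_expi2pi_onto (set_mem (valP x)).
by exists t; apply: val_inj.
Qed.

Lemma iter_circle_point (R : realType) (T : circle R -> circle R) (F : R -> R) :
  (forall s, T (circle_point s) = circle_point (F s)) ->
  forall n t, iter n T (circle_point t) = circle_point (iter n F t).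
Proof. by move=> TF; elim=> //= n IH t; rewrite IH TF. Qed.

Unset Implicit Arguments.

Theorem corollary11 (R : realType) (c : nat -> R[i]) (lam : R)
    (hosc : oscillating c) (hlam : 1 < lam) (hgrowth : growth_condition lam c)
    (T : circle R -> circle R) (hT : denjoy_counterexample T) :
  linearly_disjoint T c.
Proof.
case: hT => _ _ [rho rho_irr [F [_ F_incr F_shift TF] F_rot]] _ f f_cont x.
have [t <-] := circle_point_onto x.
pose g s := f (circle_point s).
have g_cont : continuous g.
  by move=> s; apply: continuous_comp; [exact: continuous_circle_point|exact: f_cont].
have g_per : periodic1 g.
  by move=> s; congr f; apply: val_inj; rewrite /= expi2piD expi2pi1 mulr1.
have [B B0 gB] := periodic1_bounded g_cont g_per.
under eq_fun do under eq_bigr do rewrite (iter_circle_point TF).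
apply: (null_corr_approx hlam hgrowth) => d d0.
exact: (orbit_approx F_incr F_shift F_rot rho_irr g_cont g_per t hosc B0 gB d0).
Qed.
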